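(* Let $N$ be a connected (real, finite-dimensional) nilpotent Lie group whose Lie algebra $\mathfrak n$ satisfies $\mathfrak z(\mathfrak n)\subset[\mathfrak n,\mathfrak n]$, where $\mathfrak z(\mathfrak n)$ is the center of $\mathfrak n$. Put $u_{\mathfrak n}:=\dim\mathfrak n-\dim([\mathfrak n,\mathfrak n]+\mathfrak z(\mathfrak n))$ and $z_{\mathfrak n}:=\dim(\mathfrak z(\mathfrak n)\cap[\mathfrak n,\mathfrak n])$. Then the set $\sigma_{\operatorname{Ric}}(N)$ of signatures of the Ricci curvature of left-invariant Riemannian metrics on $N$ is $$\sigma_{\operatorname{Ric}}(N)=\left\{(s^-,s^0,s^+) \in\mathbb Z^3:\ s^-\ge u_{\mathfrak n},\ \ s^0\ge 0,\ \ s^+\ge z_{\mathfrak n},\ \ s^-+s^0+s^+=\dim\mathfrak n\right\}.$$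
   Context: The signature of a symmetric bilinear form $b$ on a finite-dimensional real vector space $V$ is the triple $\sigma(b)=(s^-,s^0,s^+)\in\mathbb Z_{\ge0}^3$ with $s^-+s^0+s^+=\dim V$, where $s^{\pm}$ is the maximal dimension of a subspace on which $\pm b$ is positive definite. For a Lie group $N$, $$\sigma_{\operatorname{Ric}}(N):=\{\sigma(\operatorname{Ric}(g)) : g \text{ a left-invariant Riemannian metric on } N\},$$ where $\operatorname{Ric}(g)$ is the Ricci curvature regarded as a symmetric $(0,2)$-tensor; by left-invariance its signature is that of its value at the identity, a symmetric bilinear form on $\mathfrak n$. Left-invariant metrics correspond to scalar products $\langle\cdot,\cdot\rangle$ on $\mathfrak n$, and for nilpotent $\mathfrak n$ the Ricci curvature at the identity is given by the well-known formula $$\operatorname{Ric}(X,Y)=-\tfrac12\sum_{i,j}\langle[X,X_i],X_j\rangle\langle[Y,X_i],X_j\rangle+\tfrac14\sum_{i,j}\langle[X_i,X_j],X\rangle\langle[X_i,X_j],Y\rangle,\quad X,Y\in\mathfrak n,$$ for any $\langle\cdot,\cdot\rangle$-orthonormal basis $\{X_i\}$ of $\mathfrak n$. *)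

(* Defs.v *)
From HB Require Import structures.
From mathcomp Require Import all_boot all_order all_algebra.
From mathcomp Require Import boolp classical_sets reals.

Set Implicit Arguments.
Unset Strict Implicit.
Unset Printing Implicit Defensive.

Import Order.TTheory GRing.Theory Num.Theory.
Local Open Scope ring_scope.

HB.mixin Record Vector_isLieAlgebra (F : fieldType) V & Vector F V := {
  lie : V -> V -> V;
  lie_linearl : forall y, linear (lie ^~ y);
  lie_linearr : forall x, linear (lie x);
  liexx : forall x, lie x x = 0;
  lie_jacobi : forall x y z,
    lie x (lie y z) + lie y (lie z x) + lie z (lie x y) = 0
}.

#[short(type="lieAlgType")]
HB.structure Definition LieAlgebra (F : fieldType) :=
  {V of Vector F V & Vector_isLieAlgebra F V}.

Section LieAlgebraTheory.
Variables (F : fieldType) (n : lieAlgType F).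
Implicit Types (x y z : n) (U W : {vspace n}).

HB.instance Definition _ x := @GRing.isLinear.Build F n n *:%R (lie x)
  (lie_linearr x).

(* The kernel of the adjoint representation; see mem_lie_center. *)
Definition lie_center : {vspace n} := lker (linfun (fun x => linfun (lie x))).

(* [U, W], the span of all brackets; see lie_prodv_sub. *)
Definition lie_prodv U W : {vspace n} :=
  <<[seq lie x y | x <- vbasis U, y <- vbasis W]>>%VS.

Definition lie_derived : {vspace n} := lie_prodv fullv fullv.

Definition lower_central (k : nat) : {vspace n} :=
  iter k (lie_prodv fullv) fullv.

Definition lie_nilpotent : Prop := exists k, lower_central k = 0%VS.

Lemma lie_ad_linear : linear (fun x => linfun (lie x) : 'End(n)).
Proof.
move=> a x y; apply/lfunP => z.
by rewrite add_lfunE scale_lfunE !lfunE /= (lie_linearl z a x y).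
Qed.

Lemma mem_lie_center x : x \in lie_center <-> forall y, lie x y = 0.
Proof.
pose adl := GRing.isLinear.Build _ _ _ _ _ lie_ad_linear.
pose ad : {linear n -> 'End(n)} := HB.pack (fun x => linfun (lie x)) adl.
have E : linfun (fun x => linfun (lie x)) x = linfun (lie x) :> 'End(n).
  by rewrite -/(linfun ad) (lfunE ad).
rewrite /lie_center memv_ker E; split=> [/eqP/lfunP h y | h].
  by have := h y; rewrite zero_lfunE lfunE.
by apply/eqP/lfunP => y; rewrite zero_lfunE lfunE /= h.
Qed.

Lemma mem_lie_prodv U W x y : x \in U -> y \in W -> lie x y \in lie_prodv U W.
Proof.
move=> xU yW.
rewrite (coord_vbasis xU) (coord_vbasis yW).
pose lr z := HB.pack_for {linear n -> n} (lie ^~ z)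
  (GRing.isLinear.Build _ _ _ _ _ (lie_linearl z)).
rewrite -[X in X \in _]/(lr _ _) linear_sum; apply: memv_suml => i _.
rewrite linearZ; apply: memvZ; rewrite /= linear_sum; apply: memv_suml => j _.
rewrite linearZ; apply: memvZ; apply: memv_span; apply/allpairsP.
by exists ((vbasis U)`_i, (vbasis W)`_j); split; rewrite ?mem_nth ?size_tuple.
Qed.

Lemma lie_prodv_sub U W (S : {vspace n}) :
  (lie_prodv U W <= S)%VS <->
  (forall x y, x \in U -> y \in W -> lie x y \in S).
Proof.
split=> [/subvP h x y xU yW|h]; first exact/h/mem_lie_prodv.
by apply/span_subvP => _ /allpairsP[[x y]/= [xU yW ->]]; apply: h; apply: vbasis_mem.
Qed.

End LieAlgebraTheory.

Arguments lie_center {F} n.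
Arguments lie_derived {F} n.
Arguments lie_nilpotent {F} n.

Section Signature.
Variables (R : realType) (V : vectType R).
Implicit Types (b : V -> V -> R) (U : {vspace V}).

Definition posdef_on U b : Prop := forall x, x \in U -> x != 0 -> 0 < b x x.

Definition max_posdef_dim b : nat :=
  \max_(k < (\dim {:V}).+1 | `[< exists2 U, \dim U = k & posdef_on U b >]) k.

(* The triple (s^-, s^0, s^+). *)
Definition signature b : int * int * int :=
  let sm := (max_posdef_dim (fun x y => - b x y))%:Z in
  let sp := (max_posdef_dim b)%:Z in
  (sm, (\dim {:V})%:Z - sm - sp, sp).

End Signature.

Section Ricci.
Variables (R : realType) (n : lieAlgType R).

Definition orthonormal_basis (g : {dot n for idfun})
    (e : (\dim {:n}).-tuple n) : Prop :=
  basis_of {:n} e /\ forall i j, g (tnth e i) (tnth e j) = (i == j)%:R.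

(* The value at the identity of the Ricci tensor of the left-invariant metric
   determined by g, for n nilpotent and e any g-orthonormal basis of n. *)
Definition ricci (g : {dot n for idfun}) (e : (\dim {:n}).-tuple n)
    (x y : n) : R :=
  - (1 / 2) * (\sum_i \sum_j
      g (lie x (tnth e i)) (tnth e j) * g (lie y (tnth e i)) (tnth e j))
  + (1 / 4) * (\sum_i \sum_j
      g (lie (tnth e i) (tnth e j)) x * g (lie (tnth e i) (tnth e j)) y).

Local Open Scope classical_set_scope.

Definition sigma_ric : set (int * int * int) :=
  [set s | exists (g : {dot n for idfun}) (e : (\dim {:n}).-tuple n),
     orthonormal_basis g e /\ s = signature (ricci g e)].

End Ricci.

Arguments sigma_ric {R} n.

(* Main.v *)
Require Import Defs.
From HB Require Import structures.
From mathcomp Require Import all_boot all_order all_algebra.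
From mathcomp Require Import boolp classical_sets reals.
From mathcomp Require Import topology normedtype derive.
From mathcomp Require Import ring lra zify.

(** Write d = dim n. Given s^- >= u and s^+ >= z with s^- + s^+ <= d, choose
    subspaces A <= K of n with A + [n, n] = n, K :&: z(n) = 0, dim A = s^- and
    dim K = d - s^+. Let a_l be a basis of A and c_m linear forms with common
    kernel K. Over all bases E of n, with dual basis T, minimise
      sum_ijk T_k([E_i, E_j])^2 + sum_lk T_k(a_l)^2 + sum_mi c_m(E_i)^2.
    A minimum exists: on a sublevel set the vectors x with all T_k(x) bounded
    form a subalgebra containing A, hence all of n, and the common kernel of
    the linear forms f with all f(E_i) bounded is an ideal contained in K,
    hence 0, so that every linear form is bounded there. Since the first sum
    is -4 times the scalar curvature of the metric g making E orthonormal,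
    whose gradient is -Ric, stationarity reads
      4 Ric(x, x) = sum_m c_m(x)^2 - sum_l g(x, a_l)^2,
    whose signature is (dim A, dim K - dim A, d - dim K). Conversely Ric is
    always negative definite on the orthogonal complement of [n, n] and
    positive definite on z(n). *)

Set Implicit Arguments.
Unset Strict Implicit.
Unset Printing Implicit Defensive.

Import Order.TTheory GRing.Theory Num.Theory.
Local Open Scope ring_scope.

(** * Elementary inequalities and a one-variable stationarity condition *)

Section RealLemmas.
Variable R : realType.

Lemma sum_sqr_eq0 (I J : finType) (f : I -> J -> R) :
  \sum_i \sum_j f i j * f i j = 0 -> forall i j, f i j = 0.
Proof.
move=> /eqP; rewrite psumr_eq0 => [/allP h i j|i _]; last first.
  by apply: sumr_ge0 => j _; rewrite -expr2 sqr_ge0.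
have := h i (mem_index_enum i); rewrite psumr_eq0 => [/allP h'|k _].
  by have := h' j (mem_index_enum j); rewrite mulf_eq0 orbb => /eqP.
by rewrite -expr2 sqr_ge0.
Qed.

Lemma sum_sqr_ge0 (I J : finType) (f : I -> J -> R) :
  0 <= \sum_i \sum_j f i j * f i j.
Proof. by do 2!apply: sumr_ge0 => ? _; rewrite -expr2 sqr_ge0. Qed.

Lemma norm_le_sqr (t b : R) : t ^+ 2 <= b -> `|t| <= b + 1.
Proof.
rewrite -real_normK ?num_real// => tb; have := sqr_ge0 (`|t| - 1).
by have := sqr_ge0 `|t|; move: tb; rewrite !expr2; nra.
Qed.

(** With [t = s ^+ 2], the function [(t - 1) * u + (t^-1 - 1) * v] vanishes at [t = 1] and has
    derivative [u - v] there. Being nonnegative for all [t > 0], it has a minimum at [t = 1], so the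
    derivative is zero. *)
Lemma stationary_coef (u v : R) :
  (forall s, 0 < s -> 0 <= (s ^+ 2 - 1) * u + (s ^- 2 - 1) * v) -> u = v.
Proof.
move=> h; apply/eqP; rewrite -subr_eq0; apply: contraT => w0.
(* An explicit descent step replaces the derivative. [M] exceeds both [w] and [u], so
   [t = 1 - w / M] is positive and the value there, [(w / M) ^+ 2 / t * (u - M)], is negative. *)
set w := u - v in w0; pose M := 2 * (`|u| + `|w| + 1).
have M0 : 0 < M by rewrite /M; have := normr_ge0 u; have := normr_ge0 w; lra.
pose t := 1 - w / M.
have t0 : 0 < t.
  rewrite subr_gt0 ltr_pdivrMr// mul1r /M.
  by have := ler_norm w; have := normr_ge0 u; have := normr_ge0 w; lra.
have := h (Num.sqrt t); rewrite sqrtr_gt0 sqr_sqrtr ?(ltW t0)// => /(_ t0).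
rewrite leNgt => /negP[].
have -> : (t - 1) * u + (t^-1 - 1) * v = (w / M) ^+ 2 / t * (u - M).
  have -> : v = u - w by rewrite /w; ring.
  have t0' : t != 0 by rewrite gt_eqF.
  have -> : (w / M) = 1 - t by rewrite /t; ring.
  have -> : w = (1 - t) * M by rewrite /t; field; rewrite gt_eqF.
  by field.
rewrite nmulr_llt0.
  by rewrite divr_gt0// exprn_even_gt0//= mulf_neq0 ?invr_neq0// gt_eqF.
by rewrite /M; have := ler_norm u; have := normr_ge0 u; have := normr_ge0 w; lra.
Qed.

End RealLemmas.

(** * Linear algebra and signatures *)

Section ScalarForms.
Variables (F : fieldType) (V : vectType F).
Implicit Types f : V -> F.

Lemma scalar_sum f (I : finType) (c : I -> F) (v : I -> V) :
  scalar f -> f (\sum_i c i *: v i) = \sum_i c i * f (v i).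
Proof.
move=> fL; pose f' : {scalar V} := HB.pack f (GRing.isLinear.Build _ _ _ _ f fL).
by rewrite -[f]/(f' : _ -> _) linear_sum; apply: eq_bigr => i _; rewrite linearZ.
Qed.

Lemma scalar_zero f : scalar f -> f 0 = 0.
Proof. by move=> fL; have := fL (-1) 0 0; rewrite scaler0 addr0 mulN1r addNr. Qed.

Lemma scalar_add f x y : scalar f -> f (x + y) = f x + f y.
Proof. by move=> fL; have := fL 1 x y; rewrite scale1r mul1r. Qed.

Lemma scalar_scale f a x : scalar f -> f (a *: x) = a * f x.
Proof. by move=> fL; have := fL a x 0; rewrite (scalar_zero fL) !addr0. Qed.

Lemma scalar_opp f x : scalar f -> f (- x) = - f x.
Proof. by move=> fL; rewrite -scaleN1r scalar_scale// mulN1r. Qed.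

Variables (r : nat) (f : 'I_r -> V -> F).
Hypothesis fL : forall i, scalar (f i).

Let row_linear : linear (fun x => \row_i f i x).
Proof. by move=> a x y; apply/rowP => i; rewrite !mxE fL. Qed.

Let rowf : {linear V -> 'rV[F]_r} :=
  HB.pack (fun x => \row_i f i x) (GRing.isLinear.Build _ _ _ _ _ row_linear).

Definition common_kernel : {vspace V} := lker (linfun rowf).

Lemma mem_common_kernel x :
  reflect (forall i, f i x = 0) (x \in common_kernel).
Proof.
rewrite memv_ker lfunE /=; apply: (iffP eqP) => [/rowP h i | h].
  by have := h i; rewrite !mxE.
by apply/rowP => i; rewrite !mxE h.
Qed.

Lemma dim_common_kernel : (\dim {:V} <= r + \dim common_kernel)%N.
Proof.
rewrite -(limg_ker_dim (linfun rowf) fullv) capfv addnC leq_add2r.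
by rewrite (leq_trans (dimvS (subvf _)))// dimvf /dim /= mul1n.
Qed.

(** When the common kernel is trivial, [x] is recovered linearly from the row of values [f i x].
    Hence [h] factors through that row, and its values on the preimages of the unit rows are the
    coefficients. *)
Lemma scalar_span (h : V -> F) : common_kernel = 0%VS -> scalar h ->
  exists c : 'I_r -> F, forall x, h x = \sum_i c i * f i x.
Proof.
move=> /eqP k0 hL; pose e i : 'rV[F]_r := delta_mx 0 i.
exists (fun i => h ((linfun rowf)^-1%VF (e i))) => x.
rewrite -{1}(lker0_lfunK k0 x) lfunE /= (row_sum_delta (\row_i f i x)).
rewrite linear_sum.
rewrite (eq_bigr (fun i => f i x *: (linfun rowf)^-1%VF (e i))); last first.
  by move=> i _; rewrite -linearZ mxE.
by rewrite scalar_sum//; apply: eq_bigr => i _; rewrite mulrC.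
Qed.

End ScalarForms.

Section Subspaces.
Variables (F : fieldType) (V : vectType F).

Lemma ex_max_dim (P : {vspace V} -> Prop) : (exists U, P U) ->
  exists U, P U /\ forall W, P W -> (\dim W <= \dim U)%N.
Proof.
move=> exP; pose Q k := `[< exists2 U, \dim U = k & P U >].
have exQ : exists k, Q k.
  by case: exP => U PU; exists (\dim U); apply/asboolP; exists U.
have bQ k : Q k -> (k <= \dim {:V})%N.
  by move=> /asboolP[U <- _]; exact/dimvS/subvf.
case: (ex_maxnP exQ bQ) => k /asboolP[U <- PU] max.
by exists U; split=> // W PW; apply: max; apply/asboolP; exists W.
Qed.

(** Take [U] of maximal dimension among the subspaces on which [P] holds. Adjoining the line of any
    [x] satisfying [P] preserves this property, so maximality puts [x] in [U]. *)
Lemma submodule_vspace (P : V -> Prop) : P 0 ->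
  (forall a x y, P x -> P y -> P (a *: x + y)) ->
  exists U : {vspace V}, forall x, x \in U <-> P x.
Proof.
move=> P0 PL.
have [|U [PU maxU]] := @ex_max_dim (fun U => forall x, x \in U -> P x).
  by exists 0%VS => x; rewrite memv0 => /eqP->.
exists U => x; split=> [|Px]; first exact: PU.
have /maxU : forall y, y \in (<[x]> + U)%VS -> P y.
  by move=> y /memv_addP[_ /vlineP[k ->] [z /PU Pz ->]]; apply: PL.
move=> dimle; have : (U == <[x]> + U)%VS by rewrite eqEdim addvSr.
by move=> /eqP->; apply: (subvP (addvSl _ _)); exact: memv_line.
Qed.

Lemma ex_subv_dim (U W : {vspace V}) k :
  (U <= W)%VS -> (\dim U <= k <= \dim W)%N ->
  exists A : {vspace V}, [/\ (U <= A)%VS, (A <= W)%VS & \dim A = k].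
Proof.
move=> UW /andP[Uk kW].
have [j jk] : exists j, k = (\dim U + j)%N by exists (k - \dim U)%N; rewrite subnKC.
elim: j k jk Uk kW => [|j IH] k -> Uk kW.
  by exists U; rewrite addn0 subvv.
have [||A [UA AW dA]] := IH (\dim U + j)%N erefl; rewrite ?leq_addr//.
  by apply: leq_trans kW; rewrite leq_add2l.
have /subvPn[x xW xA] : ~~ (W <= A)%VS.
  by apply/negP => /dimvS; rewrite dA => h; move: kW; rewrite addnS leqNgt ltnS h.
exists (A + <[x]>)%VS; split.
- exact: subv_trans UA (addvSl _ _).
- by rewrite subv_add AW -memvE.
rewrite dimv_disjoint_sum ?dA ?dim_vline.
  by have -> : x != 0; [apply: contraNneq xA => ->; rewrite mem0v|rewrite addn1 addnS].
apply/eqP; rewrite -subv0; apply/subvP => y /memv_capP[yA /vlineP[c yE]].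
rewrite memv0 yE; case: (eqVneq c 0) => [->|c0]; first by rewrite scale0r.
by case/negP: xA; rewrite -[x](scalerK c0) memvZ // -yE.
Qed.

Lemma dim_disjoint (U W : {vspace V}) :
  (forall x, x \in U -> x \in W -> x = 0) -> (\dim U + \dim W <= \dim {:V})%N.
Proof.
move=> h; rewrite -dimv_disjoint_sum ?dimvS ?subvf//.
apply/eqP; rewrite -subv0; apply/subvP => x /memv_capP[xU xW].
by rewrite memv0 (h x).
Qed.

End Subspaces.

Section SignatureTheory.
Variables (R : realType) (V : vectType R).
Implicit Types (b : V -> V -> R) (U W : {vspace V}).

Lemma leq_max_posdef_dim b U : posdef_on U b -> (\dim U <= max_posdef_dim b)%N.
Proof.
move=> bU; have dU : (\dim U < (\dim {:V}).+1)%N by rewrite ltnS dimvS ?subvf.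
rewrite /max_posdef_dim.
by apply: (@bigop.bigmax_sup _ (Ordinal dU)) => //; apply/asboolP; exists U.
Qed.

Lemma max_posdef_dim_attained b :
  exists2 U, \dim U = max_posdef_dim b & posdef_on U b.
Proof.
have p0 : posdef_on 0%VS b by move=> x; rewrite memv0 => ->.
rewrite /max_posdef_dim.
have [|k /asboolP kP ->] := @eq_bigmax_cond _
   (fun k : 'I_(\dim {:V}).+1 => `[< exists2 U, \dim U = k &
     posdef_on U b >]) (@nat_of_ord _).
  apply/card_gt0P; exists ord0; rewrite unfold_in; apply/asboolP.
  by exists 0%VS => //; rewrite dimv0.
by case: kP => U ? ?; exists U.
Qed.

(** A subspace on which [b] is positive definite meets [W] only in zero, so its dimension is at most
    the codimension of [W], hence at most [\dim U]. *)
Lemma max_posdef_dimE b U W : posdef_on U b -> (forall x, x \in W -> b x x <= 0) ->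
  (\dim {:V} <= \dim U + \dim W)%N -> max_posdef_dim b = \dim U.
Proof.
move=> bU bW dUW; apply/eqP; rewrite eqn_leq leq_max_posdef_dim// andbT.
have [U' <- bU'] := max_posdef_dim_attained b.
rewrite -(leq_add2r (\dim W)); apply: leq_trans dUW; apply: dim_disjoint => x xU xW.
by apply/eqP; apply: contraTT (bW x xW) => x0; rewrite -ltNge bU'.
Qed.

Lemma posdef_dim_add_leq b :
  (max_posdef_dim (fun x y => - b x y) + max_posdef_dim b <= \dim {:V})%N.
Proof.
have [U <- bU] := max_posdef_dim_attained (fun x y => - b x y).
have [W <- bW] := max_posdef_dim_attained b.
apply: dim_disjoint => x xU xW; apply/eqP; apply: contraT => x0.
by have := bU x xU x0; rewrite oppr_gt0 => /lt_gtF; rewrite bW.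
Qed.

Variable g : {dot V for idfun}.

Lemma dotC x y : g x y = g y x.
Proof. by rewrite hermitian_subproof expr0 mul1r. Qed.

Lemma dot_scalar x : scalar (g x).
Proof. by move=> a y z; rewrite linearPr. Qed.

Lemma dot_eq0 x : g x x = 0 -> x = 0.
Proof. by apply: contra_eq => /(neq0_dnorm_gt0 (s := g)) /gt_eqF ->. Qed.

Definition orthov_of U : {vspace V} :=
  common_kernel (fun i : 'I_(\dim U) => dot_scalar (vbasis U)`_i).

Lemma dim_orthov_of U : (\dim {:V} <= \dim U + \dim (orthov_of U))%N.
Proof. exact: dim_common_kernel. Qed.

Lemma mem_orthov_of U x : x \in orthov_of U -> forall y, y \in U -> g x y = 0.
Proof.
move=> /mem_common_kernel h y yU; rewrite (coord_vbasis yU).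
rewrite (scalar_sum _ _ (dot_scalar x)) big1// => i _.
by rewrite dotC h mulr0.
Qed.

Lemma dim_orthov_ofE U : (\dim U + \dim (orthov_of U))%N = \dim {:V}.
Proof.
apply/eqP; rewrite eqn_leq dim_orthov_of andbT; apply: dim_disjoint => x xU xO.
by apply: dot_eq0; apply: mem_orthov_of xO _ xU.
Qed.

End SignatureTheory.

(** * Nilpotent Lie algebras *)

Section LieTheory.
Variables (F : fieldType) (n : lieAlgType F).
Implicit Types (x y z : n) (U I : {vspace n}).

Lemma lieDl x y z : lie (x + y) z = lie x z + lie y z.
Proof. by have := lie_linearl z 1 x y; rewrite !scale1r. Qed.

Lemma lieC x y : lie x y = - lie y x.
Proof.
have := liexx (x + y); rewrite lieDl !linearD /= !liexx add0r addr0.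
by move=> /eqP; rewrite addr_eq0 => /eqP.
Qed.

Lemma lie_suml (J : finType) (c : J -> F) (v : J -> n) y :
  lie (\sum_i c i *: v i) y = \sum_i c i *: lie (v i) y.
Proof.
rewrite lieC linear_sum -sumrN; apply: eq_bigr => i _.
by rewrite linearZ /= -scalerN -lieC.
Qed.

Lemma scalar_liel (f : n -> F) y : scalar f -> scalar (fun z => f (lie z y)).
Proof. by move=> fL a z w; rewrite lie_linearl fL. Qed.

Lemma scalar_lier (f : n -> F) y : scalar f -> scalar (fun z => f (lie y z)).
Proof. by move=> fL a z w; rewrite lie_linearr fL. Qed.

Lemma lie_derived_mem x y : lie x y \in lie_derived n.
Proof. exact: mem_lie_prodv (memvf x) (memvf y). Qed.

Hypothesis nil_n : lie_nilpotent n.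

(** Write C_j for the lower central series. If U + C_j is everything, expanding a bracket of two
    sums gives [n, n] <= U + C_(j+1), so U + C_(j+1) is everything too. At the end of the series,
    C_k = 0. *)
Lemma nilpotent_generated U : (U + lie_derived n)%VS = fullv ->
  (forall x y, x \in U -> y \in U -> lie x y \in U) -> U = fullv.
Proof.
move=> UD Ulie; case: nil_n => k nk.
suff h j : (U + lower_central n j)%VS = fullv by rewrite -(h k) nk addv0.
elim: j => [|j IH]; first by rewrite addvf.
apply: subv_anti; rewrite subvf /= -{1}UD subv_add addvSl /=.
have cS y z : z \in lower_central n j -> lie y z \in lower_central n j.+1.
  by move=> zj; apply: mem_lie_prodv zj; exact: memvf.
apply/lie_prodv_sub => x y _ _.
have /memv_addP[x1 x1U [x2 x2C ->]] : x \in (U + lower_central n j)%VS.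
  by rewrite IH memvf.
have /memv_addP[y1 y1U [y2 y2C ->]] : y \in (U + lower_central n j)%VS.
  by rewrite IH memvf.
rewrite linearD /= lieDl -addrA memv_add ?Ulie// memvD//; last exact: cS.
by rewrite lieC memvN cS.
Qed.

(** Climb the lower central series from its zero term. If I meets C_(j+1) trivially, every bracket
    with an x in I and C_j lies in that intersection, so x is central and therefore zero. *)
Lemma nilpotent_ideal_eq0 I : (forall x y, x \in I -> lie y x \in I) ->
  (I :&: lie_center n)%VS = 0%VS -> I = 0%VS.
Proof.
move=> Ilie Iz; case: nil_n => k nk.
suff h j : (j <= k)%N -> (I :&: lower_central n (k - j))%VS = 0%VS.
  by have := h k (leqnn k); rewrite subnn capvf.
elim: j => [_|j IH jk]; first by rewrite subn0 nk capv0.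
apply/eqP; rewrite -subv0; apply/subvP => x /memv_capP[xI xC].
rewrite -Iz memv_cap xI; apply/mem_lie_center => y.
apply/eqP; rewrite lieC oppr_eq0 -memv0 -(IH (ltnW jk)) memv_cap Ilie//=.
have -> : (k - j = (k - j.+1).+1)%N by lia.
by apply: mem_lie_prodv xC; exact: memvf.
Qed.

End LieTheory.

(** * Definiteness of the Ricci form that holds for every metric *)

Section Necessity.
Variables (R : realType) (n : lieAlgType R).
Variables (g : {dot n for idfun}) (e : (\dim {:n}).-tuple n).
Hypothesis e_on : orthonormal_basis g e.
Hypothesis cen_n : (lie_center n <= lie_derived n)%VS.

Let span_e x : x = \sum_i coord e i x *: tnth e i.
Proof.
case: e_on => be _; rewrite {1}(coord_basis be (memvf x)).
by apply: eq_bigr => i _; rewrite (tnth_nth 0).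
Qed.

Lemma basis_dot_eq0 x : (forall i, g x (tnth e i) = 0) -> x = 0.
Proof.
move=> h; apply: (dot_eq0 (g := g)); rewrite {2}(span_e x).
by rewrite (scalar_sum _ _ (dot_scalar g x)) big1// => i _; rewrite h mulr0.
Qed.

(** For central [x] only the positive sum survives. If it vanishes, [x] is orthogonal to all
    brackets, hence to the derived algebra, which contains [x]. *)
Lemma ricci_posdef_center : posdef_on (lie_center n) (ricci g e).
Proof.
move=> x xz x0; rewrite /ricci [X in _ * X + _]big1 => [|i _]; last first.
  apply: big1 => j _; rewrite (iffLR (mem_lie_center x) xz).
  by rewrite (dotC g) (scalar_zero (dot_scalar g _)) mul0r.
rewrite mulr0 add0r mulr_gt0 ?divr_gt0// lt_def sum_sqr_ge0 andbT.
apply: contra_neq x0 => /sum_sqr_eq0 h; apply: (dot_eq0 (g := g)).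
have xD y : y \in lie_derived n -> g x y = 0.
  pose V := common_kernel (fun _ : 'I_1 => dot_scalar g x).
  suff /subvP h' : (lie_derived n <= V)%VS by move=> /h' /mem_common_kernel/(_ ord0).
  apply/lie_prodv_sub => a b _ _; apply/mem_common_kernel => _.
  rewrite (span_e a) lie_suml (scalar_sum _ _ (dot_scalar g x)) big1// => i _.
  rewrite (span_e b) linear_sum /=; under eq_bigr do rewrite linearZ /=.
  rewrite (scalar_sum _ _ (dot_scalar g x)) big1 ?mulr0// => j _.
  by rewrite dotC h mulr0.
exact/xD/(subvP cen_n).
Qed.

(** Orthogonality to brackets leaves only the negative sum. If it vanishes, [x] is central, hence in
    the derived algebra and orthogonal to itself. *)
Lemma ricci_negdef_orthov :
  posdef_on (orthov_of g (lie_derived n)) (fun x y => - ricci g e x y).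
Proof.
move=> x /mem_orthov_of xD x0; rewrite /ricci [X in _ + _ * X]big1 => [|i _]; last first.
  by apply: big1 => j _; rewrite dotC xD ?mul0r// lie_derived_mem.
rewrite mulr0 addr0 -mulNr opprK mulr_gt0 ?divr_gt0// lt_def sum_sqr_ge0 andbT.
apply: contra_neq x0 => /sum_sqr_eq0 h; apply: (dot_eq0 (g := g)); apply: xD.
apply: (subvP cen_n); apply/mem_lie_center => y.
rewrite (span_e y) linear_sum big1// => i _; rewrite linearZ /=.
by rewrite (basis_dot_eq0 (h i)) scaler0.
Qed.

End Necessity.

(** * The energy of a frame *)

Section Frames.
Variables (R : realType) (n : lieAlgType R).
Local Notation d := (\dim {:n}).
Implicit Types (E : 'I_d -> n) (T : 'I_d -> n -> R).

(** Biorthogonality with [d] forms already makes [E] a basis, with [T] as its dual basis. Carrying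
    [T] as data keeps the energy polynomial in the pair. *)
Definition frame E T :=
  (forall k, scalar (T k)) /\ forall i k, T k (E i) = (i == k)%:R.

Definition frame_tuple E : d.-tuple n := [tuple E i | i < d].

Lemma tnth_frame_tuple E i : tnth (frame_tuple E) i = E i.
Proof. exact: tnth_mktuple. Qed.

Section FrameTheory.
Variables (E : 'I_d -> n) (T : 'I_d -> n -> R).
Hypothesis ET : frame E T.

Let TL k : scalar (T k). Proof. by case: ET. Qed.
Let TE i k : T k (E i) = (i == k)%:R. Proof. by case: ET. Qed.

Let frame_coord (c : 'I_d -> R) k : T k (\sum_i c i *: E i) = c k.
Proof.
rewrite (scalar_sum _ _ (TL k)) (bigD1 k)//= TE eqxx mulr1 big1 ?addr0// => i ik.
by rewrite TE (negPf ik) mulr0.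
Qed.

Lemma frame_basis : basis_of {:n} (frame_tuple E).
Proof.
rewrite basisEfree subvf size_tuple leqnn /= andbT.
apply/(freeP (X := frame_tuple E)) => c h i.
rewrite -(frame_coord c i) -[RHS](scalar_zero (TL i)); congr (T i _).
by rewrite -[RHS]h; apply: eq_bigr => j _; rewrite -tnth_nth tnth_frame_tuple.
Qed.

Lemma frame_sum x : x = \sum_i T i x *: E i.
Proof.
have h : x = \sum_i coord (frame_tuple E) i x *: E i.
  rewrite {1}(coord_basis frame_basis (memvf x)); apply: eq_bigr => i _.
  by rewrite -tnth_nth tnth_frame_tuple.
by rewrite {1}h; apply: eq_bigr => i _; rewrite {2}h frame_coord.
Qed.

Lemma scalar_frame f x : scalar f -> f x = \sum_i T i x * f (E i).
Proof. by move=> fL; rewrite {1}(frame_sum x) scalar_sum. Qed.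

Definition frame_dotf x y := \sum_k T k x * T k y.

Let frame_dot_bilinear : bilinear_for *%R (idfun \; *%R) frame_dotf.
Proof.
split=> [y a x z|x a y z] /=; rewrite /frame_dotf mulr_sumr -big_split;
  by apply: eq_bigr => k _ /=; rewrite TL; ring.
Qed.

Let frame_dotC x y : frame_dotf x y = (-1) ^+ false * idfun (frame_dotf y x).
Proof. by rewrite expr0 mul1r; apply: eq_bigr => k _; rewrite mulrC. Qed.

Let frame_dot_gt0 x : x != 0 -> 0 < frame_dotf x x.
Proof.
move=> x0; rewrite lt_def sumr_ge0 ?andbT => [|k _]; last by rewrite -expr2 sqr_ge0.
apply: contra_neq x0 => /eqP; rewrite psumr_eq0 => [/allP h|k _]; last first.
  by rewrite -expr2 sqr_ge0.
rewrite (frame_sum x) big1// => i _.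
by have := h i (mem_index_enum i); rewrite mulf_eq0 orbb => /eqP->; rewrite scale0r.
Qed.

Definition frame_dot : {dot n for idfun} := HB.pack frame_dotf
  (bilinear_isBilinear.Build _ _ _ _ _ _ frame_dotf frame_dot_bilinear)
  (isHermitianSesquilinear.Build _ _ false idfun frame_dotf frame_dotC)
  (isDotProduct.Build _ _ frame_dotf frame_dot_gt0).

Lemma frame_dotE x y : frame_dot x y = \sum_k T k x * T k y.
Proof. by []. Qed.

Lemma frame_dotr x i : frame_dot x (E i) = T i x.
Proof.
rewrite frame_dotE (bigD1 i)//= TE eqxx mulr1 big1 ?addr0// => k ki.
by rewrite TE eq_sym (negPf ki) mulr0.
Qed.

Lemma frame_orthonormal : orthonormal_basis frame_dot (frame_tuple E).
Proof.
split=> [|i j]; first exact: frame_basis.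
by rewrite !tnth_frame_tuple frame_dotr TE.
Qed.

(** * Varying a frame along one direction *)

Section Variation.
Variables (x : n) (s : R).
Hypotheses (x0 : x != 0) (s0 : 0 < s).
Let N : R := frame_dot x x.
Let N0 : N != 0. Proof. by rewrite gt_eqF// frame_dot_gt0. Qed.

(* Rescale the x-direction by s and fix its orthogonal complement. *)
Definition stretch_vec i : n := E i + ((s - 1) / N * T i x) *: x.
Definition stretch_form k y : R :=
  T k y + (s^-1 - 1) / N * T k x * frame_dot x y.

(** Since [T i x] is the product of [x] and [E i], the new vectors are the images of [E] under the
    stretching map; the new forms are those of [T] composed with its inverse, which stretches by
    [s^-1]. *)
Lemma frame_stretch : frame stretch_vec stretch_form.
Proof.
have gL := dot_scalar frame_dot x.
split=> [k a y z|i k]; first by rewrite /stretch_form TL gL; ring.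
rewrite /stretch_form /stretch_vec !(scalar_add _ _ gL, scalar_scale _ _ gL).
rewrite !(scalar_add _ _ (TL k), scalar_scale _ _ (TL k)) TE frame_dotr -/N.
by field; rewrite N0 gt_eqF.
Qed.

(** Expand the square: the cross terms sum to a multiple of [f x] because [T i x] are the
    coordinates of [x]. With [k = (s - 1) / N], the total coefficient is
    [2 * k + k ^+ 2 * N = (s ^+ 2 - 1) / N]. *)
Lemma sum_sqr_stretch_vec f : scalar f ->
  \sum_i f (stretch_vec i) ^+ 2 =
  \sum_i f (E i) ^+ 2 + (s ^+ 2 - 1) / N * f x ^+ 2.
Proof.
move=> fL; pose k := (s - 1) / N.
have h i : f (stretch_vec i) ^+ 2 = f (E i) ^+ 2 +
    (2 * k * f x) * (T i x * f (E i)) + (k * f x) ^+ 2 * (T i x * T i x).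
  by rewrite /stretch_vec (scalar_add _ _ fL) (scalar_scale _ _ fL) -/k; ring.
rewrite (eq_bigr _ (fun i _ => h i)) !big_split /= -!mulr_sumr -scalar_frame//.
by rewrite -frame_dotE -/N /k; field.
Qed.

Lemma sum_sqr_stretch_form y :
  \sum_k stretch_form k y ^+ 2 =
  \sum_k T k y ^+ 2 + (s ^- 2 - 1) / N * frame_dot x y ^+ 2.
Proof.
pose c := (s^-1 - 1) / N.
have h k : stretch_form k y ^+ 2 = T k y ^+ 2 +
    (2 * c * frame_dot x y) * (T k x * T k y)
    + (c * frame_dot x y) ^+ 2 * (T k x * T k x).
  by rewrite /stretch_form -/c; ring.
rewrite (eq_bigr _ (fun i _ => h i)) !big_split /= -!mulr_sumr -!frame_dotE -/N.
by rewrite -[frame_dotf x y]/(frame_dot x y) /c; field; rewrite N0 gt_eqF.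
Qed.

(** Stretch one slot of the bracket at a time. The two slots contribute equally by antisymmetry, and
    the doubly stretched term contains [lie x x = 0]. *)
Lemma sum_sqr_lie_stretch f : scalar f ->
  \sum_i \sum_j f (lie (stretch_vec i) (stretch_vec j)) ^+ 2 =
  \sum_i \sum_j f (lie (E i) (E j)) ^+ 2
  + 2 * ((s ^+ 2 - 1) / N) * \sum_i f (lie x (E i)) ^+ 2.
Proof.
move=> fL; under eq_bigr do rewrite (sum_sqr_stretch_vec (scalar_lier _ fL)).
rewrite big_split /= -mulr_sumr exchange_big /=.
under eq_bigr do rewrite (sum_sqr_stretch_vec (scalar_liel _ fL)).
rewrite (sum_sqr_stretch_vec (scalar_liel _ fL)) big_split /= -mulr_sumr.
rewrite exchange_big /= liexx (scalar_zero fL) expr0n mulr0 addr0.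
have -> : \sum_i f (lie (E i) x) ^+ 2 = \sum_i f (lie x (E i)) ^+ 2.
  by apply: eq_bigr => i _; rewrite lieC (scalar_opp _ fL) sqrrN.
ring.
Qed.

End Variation.

End FrameTheory.

(** * The energy and its stationarity equation *)

Section Energy.
Variables (q p : nat) (a : 'I_q -> n) (c : 'I_p -> n -> R).
Hypothesis cL : forall m, scalar (c m).

Definition energy E T : R :=
  \sum_i \sum_j \sum_k T k (lie (E i) (E j)) ^+ 2
  + \sum_l \sum_k T k (a l) ^+ 2 + \sum_m \sum_i c m (E i) ^+ 2.

Lemma energy_stretch E T (ET : frame E T) x s : x != 0 -> 0 < s ->
  let g := frame_dot ET in
  energy (stretch_vec ET x s) (stretch_form ET x s) = energy E T
  + (s ^+ 2 - 1) / g x x *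
    (2 * (\sum_i \sum_k T k (lie x (E i)) ^+ 2) + \sum_m c m x ^+ 2)
  + (s ^- 2 - 1) / g x x *
    (\sum_i \sum_j g x (lie (E i) (E j)) ^+ 2 + \sum_l g x (a l) ^+ 2
     + 2 * ((s ^+ 2 - 1) / g x x) * (\sum_i g x (lie x (E i)) ^+ 2)).
Proof.
move=> x0 s0 g; have TL k : scalar (T k) by exact: ET.1.
rewrite /energy.
under eq_bigr => i _ do under eq_bigr => j _ do
  rewrite (sum_sqr_stretch_form ET x0 s0).
under eq_bigr => i _ do rewrite big_split /= -mulr_sumr.
rewrite big_split /= -mulr_sumr -/g.
rewrite (sum_sqr_lie_stretch ET s x0 (dot_scalar g x)) -/g.
under eq_bigr => i _ do rewrite exchange_big /=.
rewrite exchange_big /=.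
under eq_bigr => k _ do rewrite (sum_sqr_lie_stretch ET s x0 (TL k)).
rewrite big_split /= -mulr_sumr -/g.
rewrite [X in 2 * _ * X]exchange_big /= exchange_big /=.
under [X in X + 2 * _ * _]eq_bigr => i _ do rewrite exchange_big /=.
under [X in _ + X + _]eq_bigr => l _ do rewrite (sum_sqr_stretch_form ET x0 s0) -/g.
under [X in _ + X = _]eq_bigr => m _ do rewrite (sum_sqr_stretch_vec ET s x0 (cL m)) -/g.
rewrite !big_split /= -!mulr_sumr.
ring.
Qed.

(** Stretching along [x] cannot lower the minimal energy. The resulting first-order condition is
    [2 * A + C' = B + A'], while the Ricci form at [x] is [(B - 2 * A) / 4]. *)
Lemma ricci_min_frame E T (ET : frame E T) :
  (forall E' T', frame E' T' -> energy E T <= energy E' T') ->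
  forall x, ricci (frame_dot ET) (frame_tuple E) x x =
    1 / 4 * (\sum_m c m x ^+ 2 - \sum_l frame_dot ET x (a l) ^+ 2).
Proof.
move=> min x; set g := frame_dot ET.
have gL y := dot_scalar g y; have g0 y : g 0 y = 0 by rewrite dotC (scalar_zero (gL y)).
have [->|x0] := eqVneq x 0.
  rewrite /ricci !big1 ?mulr0 ?addr0 ?subr0 ?mulr0 //.
  - by move=> l _; rewrite g0 expr0n.
  - by move=> m _; rewrite (scalar_zero (cL m)) expr0n.
  - by move=> i _; rewrite big1// => j _; rewrite (scalar_zero (gL _)) mul0r.
  - by move=> i _; rewrite big1// => j _; rewrite lieC linear0 oppr0 g0 mul0r.
pose A := \sum_i \sum_k T k (lie x (E i)) ^+ 2.
pose B := \sum_i \sum_j g x (lie (E i) (E j)) ^+ 2.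
pose D := \sum_i g x (lie x (E i)) ^+ 2.
pose C' := \sum_m c m x ^+ 2.
pose A' := \sum_l g x (a l) ^+ 2.
pose N := g x x.
have N0 : 0 < N by exact: neq0_dnorm_gt0.
(* The mixed factor [(s ^+ 2 - 1) * (s ^- 2 - 1)] equals [- (s ^+ 2 - 1) - (s ^- 2 - 1)], so the
   term in [D] enters both coefficients equally and cancels. *)
have : (2 * A + C') / N - 2 / N ^+ 2 * D = (B + A') / N - 2 / N ^+ 2 * D.
  apply: stationary_coef => s s0.
  have := min _ _ (frame_stretch ET x0 s0).
  rewrite energy_stretch // -/g -/N -/A -/B -/D -/C' -/A' -addrA lerDl.
  rewrite [X in 0 <= X -> _](_ : _ =
    (s ^+ 2 - 1) * ((2 * A + C') / N - 2 / N ^+ 2 * D) +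
    (s ^- 2 - 1) * ((B + A') / N - 2 / N ^+ 2 * D)) //.
  by field; rewrite !gt_eqF.
move=> /addIr /(mulIf (invr_neq0 (lt0r_neq0 N0))) crit.
rewrite /ricci -/C' -/A'.
have -> : \sum_i \sum_j g (lie x (tnth (frame_tuple E) i)) (tnth (frame_tuple E) j)
    * g (lie x (tnth (frame_tuple E) i)) (tnth (frame_tuple E) j) = A.
  by apply: eq_bigr => i _; apply: eq_bigr => j _; rewrite !tnth_frame_tuple frame_dotr.
have -> : \sum_i \sum_j g (lie (tnth (frame_tuple E) i) (tnth (frame_tuple E) j)) x
    * g (lie (tnth (frame_tuple E) i) (tnth (frame_tuple E) j)) x = B.
  by apply: eq_bigr => i _; apply: eq_bigr => j _; rewrite !tnth_frame_tuple dotC.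
have -> : C' = B + A' - 2 * A by rewrite -crit; ring.
by field.
Qed.

End Energy.
End Frames.

Import numFieldNormedType.Exports.

(** * Existence of a minimal frame *)

Section MinimalFrame.
Variables (R : realType) (n : lieAlgType R).
Local Notation d := (\dim {:n}).
Implicit Types (E : 'I_d -> n) (T : 'I_d -> n -> R).
Variables (q p : nat) (a : 'I_q -> n) (c : 'I_p -> n -> R).
Hypothesis cL : forall m, scalar (c m).
Hypothesis nil_n : lie_nilpotent n.
Hypothesis a_gen : (<<codom a>> + lie_derived n)%VS = fullv.
Hypothesis c_sep : (common_kernel cL :&: lie_center n)%VS = 0%VS.

(** * Uniform bounds on a sublevel set of the energy *)

Section Sublevel.
Variable M : R.

Definition sublevel E T := frame E T /\ energy a c E T <= M.

Let term_le (I : finType) (F : I -> R) i :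
  (forall j, 0 <= F j) -> F i <= \sum_j F j.
Proof. by move=> F0; rewrite (bigD1 i)//= lerDl sumr_ge0. Qed.

Let sub_bound E T : sublevel E T ->
  [/\ forall i j k, `|T k (lie (E i) (E j))| <= M + 1,
      forall l k, `|T k (a l)| <= M + 1 & forall m i, `|c m (E i)| <= M + 1].
Proof.
case=> _; rewrite /energy.
set e1 := \sum_i \sum_j _; set e2 := \sum_l _; set e3 := \sum_m _ => leM.
have e1_ge0 : 0 <= e1 by do 3!apply: sumr_ge0 => ? _; rewrite sqr_ge0.
have e2_ge0 : 0 <= e2 by do 2!apply: sumr_ge0 => ? _; rewrite sqr_ge0.
have e3_ge0 : 0 <= e3 by do 2!apply: sumr_ge0 => ? _; rewrite sqr_ge0.
split=> [i j k|l k|m i]; apply: norm_le_sqr.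
- apply: (@le_trans _ _ e1); last by lra.
  apply: le_trans (term_le i _) => [|i'].
    apply: le_trans (term_le j _) => [|j'].
      by apply: (term_le (F := fun k => T k (lie (E i) (E j)) ^+ 2)) => k'; rewrite sqr_ge0.
    by apply: sumr_ge0 => ? _; rewrite sqr_ge0.
  by do 2!apply: sumr_ge0 => ? _; rewrite sqr_ge0.
- apply: (@le_trans _ _ e2); last by lra.
  apply: le_trans (term_le l _) => [|l'].
    by apply: (term_le (F := fun k => T k (a l) ^+ 2)) => k'; rewrite sqr_ge0.
  by apply: sumr_ge0 => ? _; rewrite sqr_ge0.
- apply: (@le_trans _ _ e3); last by lra.
  apply: le_trans (term_le m _) => [|m'].
    by apply: (term_le (F := fun i => c m (E i) ^+ 2)) => i'; rewrite sqr_ge0.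
  by apply: sumr_ge0 => ? _; rewrite sqr_ge0.
Qed.

Let sum_norm_le (F : 'I_d -> R) b : (forall i, `|F i| <= b) ->
  `|\sum_i F i| <= d%:R * b.
Proof.
move=> h; apply: le_trans (ler_norm_sum _ _ _) _.
apply: le_trans (ler_sum _ (fun i _ => h i)) _.
by rewrite sumr_const card_ord mulr_natl.
Qed.

Definition bounded_vector x := exists b : R, forall E T, sublevel E T ->
  forall k, `|T k x| <= b.

Definition bounded_form (f : n -> R) := exists b : R, forall E T, sublevel E T ->
  forall i, `|f (E i)| <= b.

(** Expanding both arguments in the frame turns [T k (lie x y)] into a sum of products
    [T i x * T j y * T k (lie (E i) (E j))], whose last factors the energy controls. *)
Lemma bounded_vector_lie x y :
  bounded_vector x -> bounded_vector y -> bounded_vector (lie x y).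
Proof.
move=> [bx hx] [By hy]; exists (d%:R * (bx * (d%:R * (By * (M + 1))))) => E T ET k.
have [B _ _] := sub_bound ET; have TL := ET.1.1.
rewrite (scalar_frame ET.1 x (scalar_liel y (TL k))); apply: sum_norm_le => i.
rewrite normrM ler_pM ?(hx _ _ ET)//=.
rewrite (scalar_frame ET.1 y (scalar_lier (E i) (TL k))); apply: sum_norm_le => j.
by rewrite normrM ler_pM ?(hy _ _ ET).
Qed.

(* The bounded vectors form a subalgebra containing a generating set. *)
Lemma bounded_vectorT x : bounded_vector x.
Proof.
have [||U UP] := @submodule_vspace _ n bounded_vector.
- by exists 0 => E T ET k; rewrite (scalar_zero (ET.1.1 k)) normr0.
- move=> t y z [By hy] [bz hz]; exists (`|t| * By + bz) => E T ET k.
  rewrite ET.1.1; apply: le_trans (ler_normD _ _) _; apply: lerD; last exact: (hz _ _ ET).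
  by rewrite normrM ler_wpM2l ?(hy _ _ ET).
apply/UP; suff -> : U = fullv by rewrite memvf.
apply: nilpotent_generated => // [|y z /UP By /UP bz]; last exact/UP/bounded_vector_lie.
apply: subv_anti; rewrite subvf /= -{1}a_gen addvS//.
apply/span_subvP => _ /codomP[l ->]; apply/UP; exists (M + 1) => E T ET k.
by have [_ /(_ l k)] := sub_bound ET.
Qed.

(** Expand [y], then the bracket, in the frame: the factors are coordinates of [y], structure
    constants and values [f (E k)], all bounded. *)
Lemma bounded_form_lie f y : scalar f -> bounded_form f ->
  bounded_form (fun x => f (lie y x)).
Proof.
move=> fL [b hb]; have [By hy] := bounded_vectorT y.
exists (d%:R * (By * (d%:R * ((M + 1) * b)))) => E T ET i.
have [B _ _] := sub_bound ET.
rewrite (scalar_frame ET.1 y (scalar_liel (E i) fL)); apply: sum_norm_le => j.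
rewrite normrM ler_pM ?(hy _ _ ET)//=.
rewrite (scalar_frame ET.1 _ fL); apply: sum_norm_le => k.
by rewrite normrM ler_pM ?(hb _ _ ET).
Qed.

(* The common kernel of all bounded forms is an ideal meeting the center
   trivially. *)
Lemma bounded_formT f : scalar f -> bounded_form f.
Proof.
move=> fL.
(* A finite family of bounded forms with common kernel of least dimension stands in for all of them:
   adjoining another bounded form cannot shrink the kernel, so that form vanishes on it. *)
pose P k := `[< exists (r : nat) (h : 'I_r -> n -> R) (hL : forall i, scalar (h i)),
  (forall i, bounded_form (h i)) /\ \dim (common_kernel hL) = k >].
have exP : exists k, P k.
  pose h0 (i : 'I_0) (_ : n) : R := 0.
  have h0L i : scalar (h0 i) by case: i.
  exists (\dim (common_kernel h0L)); apply/asboolP.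
  by exists 0%N, h0, h0L; split=> // -[].
case: (ex_minnP exP) => k /asboolP[r [h [hL [hb dimk]]]] mink.
have vanish f' x : scalar f' -> bounded_form f' -> x \in common_kernel hL -> f' x = 0.
  move=> f'L f'b xh.
  pose h' (i : 'I_r.+1) := if unlift ord0 i is Some j then h j else f'.
  have h'L i : scalar (h' i) by rewrite /h'; case: unliftP.
  have sub : (common_kernel h'L <= common_kernel hL)%VS.
    apply/subvP => y /mem_common_kernel hy; apply/mem_common_kernel => i.
    by have := hy (lift ord0 i); rewrite /h' liftK.
  have /mink : P (\dim (common_kernel h'L)).
    apply/asboolP; exists r.+1, h', h'L; split=> // i.
    by rewrite /h'; case: unliftP.
  rewrite -dimk => dimle.
  have /eqP eqk : (common_kernel h'L == common_kernel hL)%VS by rewrite eqEdim sub.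
  move: xh; rewrite -eqk => /mem_common_kernel/(_ ord0).
  by rewrite /h' unlift_none.
have k0 : common_kernel hL = 0%VS.
  apply: nilpotent_ideal_eq0 => // [x y xh|].
    apply/mem_common_kernel => i; apply: (vanish (fun z => h i (lie y z))) => //.
      exact: scalar_lier.
    exact: bounded_form_lie.
  apply/eqP; rewrite -subv0 -c_sep capvS//.
  apply/subvP => x xh; apply/mem_common_kernel => m; apply: vanish => //.
  by exists (M + 1) => E T ET i; have [_ _ /(_ m i)] := sub_bound ET.
have [t ft] := scalar_span k0 fL; have [b hb'] := choice hb.
exists (\sum_i `|t i| * b i) => E T ET j; rewrite ft.
apply: le_trans (ler_norm_sum _ _ _) _; apply: ler_sum => i _.
by rewrite normrM ler_wpM2l ?(hb' i _ _ ET).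
Qed.

End Sublevel.

(** * Coordinates on frames, continuity and compactness *)

Local Notation X := (vbasis {:n}).
Local Notation pt := 'rV[R]_(d * d + d * d).

(* A frame as a point of R^(2 d^2): the coordinates of the vectors E i and the
   values of the forms T k on the basis X. *)
Let P (v : pt) i b : R := v 0 (lshift (d * d) (mxvec_index i b)).
Let Q (v : pt) b k : R := v 0 (rshift (d * d) (mxvec_index b k)).
Definition point_vec (v : pt) i : n := \sum_b P v i b *: X`_b.
Definition point_form (v : pt) k x : R := \sum_b coord X b x * Q v b k.

Let point_form_scalar v k : scalar (point_form v k).
Proof.
move=> t x y; rewrite /point_form mulr_sumr -big_split; apply: eq_bigr => b _ /=.
by rewrite linearP /=; ring.
Qed.

Lemma frame_point E T : frame E T ->
  exists v, point_vec v = E /\ point_form v = T.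
Proof.
move=> ET; pose A := \matrix_(i, b) coord X b (E i).
pose B : 'M[R]_d := \matrix_(b, k) T k X`_b.
exists (row_mx (mxvec A) (mxvec B)); split.
  apply/funext => i; rewrite [RHS](coord_vbasis (memvf (E i))).
  by apply: eq_bigr => b _; rewrite /P row_mxEl mxvecE mxE.
apply/funext => k; apply/funext => x.
rewrite [in RHS](coord_vbasis (memvf x)) (scalar_sum _ _ (ET.1 k)).
by apply: eq_bigr => b _; rewrite /Q row_mxEr mxvecE mxE.
Qed.

Let contD (f h : pt -> R) : continuous f -> continuous h ->
  continuous (fun v => f v + h v).
Proof. by move=> cf ch v; apply: (continuousD (cf v) (ch v)). Qed.

Let contM (f h : pt -> R) : continuous f -> continuous h ->
  continuous (fun v => f v * h v).
Proof. by move=> cf ch v; apply: (continuousM (cf v) (ch v)). Qed.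

Let contX2 (f : pt -> R) : continuous f -> continuous (fun v => f v ^+ 2).
Proof. by move=> cf; under eq_fun do rewrite expr2; exact: contM. Qed.

Let cont_cst (t : R) : continuous (fun _ : pt => t).
Proof. exact: cst_continuous. Qed.

Let cont_sum (I : finType) (f : I -> pt -> R) : (forall i, continuous (f i)) ->
  continuous (fun v => \sum_i f i v).
Proof.
move=> cf; elim: (index_enum I) => [|i s IH].
  by under eq_fun do rewrite big_nil; exact: cont_cst.
by under eq_fun do rewrite big_cons; exact: contD.
Qed.

Let cont_vec f i : scalar f -> continuous (fun v => f (point_vec v i)).
Proof.
move=> fL; under eq_fun do rewrite (scalar_sum _ _ fL).
apply: cont_sum => b; apply: contM; last exact: cont_cst.
by move=> v; exact: coord_continuous.
Qed.

Let cont_form (y : pt -> n) k : (forall b, continuous (fun v => coord X b (y v))) ->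
  continuous (fun v => point_form v k (y v)).
Proof.
move=> cy; apply: cont_sum => b; apply: contM => // v; exact: coord_continuous.
Qed.

Let coord_scalar b : scalar (coord X b : n -> R).
Proof. by move=> t x y; rewrite linearP. Qed.

Let cont_lie f i j : scalar f ->
  continuous (fun v => f (lie (point_vec v i) (point_vec v j))).
Proof.
move=> fL; under eq_fun => v do rewrite {1}/point_vec lie_suml (scalar_sum _ _ fL).
apply: cont_sum => b; apply: contM; first by move=> v; exact: coord_continuous.
exact: (cont_vec (f := fun z => f (lie X`_b z))) (scalar_lier _ fL).
Qed.

Let cont_energy : continuous (fun v => energy a c (point_vec v) (point_form v)).
Proof.
apply: contD; [apply: contD|].
- do 3!apply: cont_sum => ?; apply: contX2; apply: cont_form => b.
  exact: cont_lie.
- by do 2!apply: cont_sum => ?; apply: contX2; apply: cont_form => b; exact: cont_cst.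
- by do 2!apply: cont_sum => ?; apply: contX2; exact: cont_vec.
Qed.

(** The duality relations packed into one continuous function, so that frames form the closed set
    where it is at most zero. *)
Let defect v := \sum_i \sum_k (point_form v k (point_vec v i) - (i == k)%:R) ^+ 2.

Let cont_defect : continuous defect.
Proof.
do 2!apply: cont_sum => ?; apply: contX2; apply: contD; last exact: cont_cst.
by apply: cont_form => b; exact: cont_vec.
Qed.

Let defectP v : defect v <= 0 <-> frame (point_vec v) (point_form v).
Proof.
split=> [h|[_ h]]; last first.
  by rewrite /defect big1// => i _; rewrite big1// => k _; rewrite h subrr expr0n.
split=> // i k; apply/eqP; rewrite -subr_eq0; apply/eqP.
have := @sum_sqr_eq0 _ _ _ (fun i k => point_form v k (point_vec v i) - (i == k)%:R).
apply; apply/eqP; rewrite eq_le sum_sqr_ge0 andbT; apply: le_trans h.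
by apply: ler_sum => i' _; apply: ler_sum => k' _; rewrite expr2.
Qed.

(** The entries [P] are values of coordinate forms on the frame vectors, and the entries [Q] are
    frame coordinates of the vectors of [X]; both kinds are uniformly bounded. *)
Let bounded_points M :
  bounded_set [set v : pt | sublevel M (point_vec v) (point_form v)]%classic.
Proof.
have /choice[b hb] x : exists b, forall v, sublevel M (point_vec v) (point_form v) ->
    forall i, `|P v i x| <= b.
  have [b hb] := bounded_formT M (coord_scalar x).
  exists b => v /hb h i; have := h i; rewrite coord_sum_free //.
  exact/basis_free/vbasisP.
have /choice[b' hb'] x : exists b, forall v, sublevel M (point_vec v) (point_form v) ->
    forall k, `|Q v x k| <= b.
  have [b' hb'] := bounded_vectorT M X`_x.
  exists b' => v /hb' h k; have := h k.
  rewrite /point_form (bigD1 x)//= coord_free ?eqxx ?mul1r ?big1 ?addr0//.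
    move=> j jx; rewrite coord_free ?(negPf jx) ?mul0r//; last exact/basis_free/vbasisP.
    by rewrite eq_sym (negPf jx) mul0r.
  exact/basis_free/vbasisP.
pose C := \sum_i `|b i| + \sum_i `|b' i|.
exists C; split=> [|M' CM' v vS]; first exact: num_real.
apply: (@le_trans _ _ C); last exact: ltW.
have C0 : 0 <= C by rewrite addr_ge0// sumr_ge0.
rewrite [leLHS]/Num.norm /= mx_normrE; apply/bigmax_leP; split=> // -[i j] _ /=.
rewrite (ord1 i); case: (split_ordP j) => k ->; case/mxvec_indexP: k => x y.
  apply: le_trans (hb y v vS x) _; apply: le_trans (ler_norm _) _.
  by rewrite /C (bigD1 y)//= -!addrA lerDl !addr_ge0// sumr_ge0.
apply: le_trans (hb' x v vS y) _; apply: le_trans (ler_norm _) _.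
by rewrite /C addrC (bigD1 x)//= -!addrA lerDl !addr_ge0// sumr_ge0.
Qed.

(** The sublevel set at the energy of the reference frame [X] is nonempty, closed and bounded, hence
    compact. A minimum there is global, as frames outside have larger energy. *)
Lemma ex_min_frame : exists E T, frame E T /\
  forall E' T', frame E' T' -> energy a c E T <= energy a c E' T'.
Proof.
have fX : frame (fun i => X`_i) (coord X : 'I_d -> n -> R).
  by split=> // i k; rewrite coord_free ?(basis_free (vbasisP _))// eq_sym.
set M := energy a c (fun i => X`_i) (coord X : 'I_d -> n -> R).
pose S := [set v : pt | sublevel M (point_vec v) (point_form v)]%classic.
have cS : closed S.
  rewrite (_ : S = defect @^-1` [set t | t <= 0] `&`
    (fun v => energy a c (point_vec v) (point_form v)) @^-1` [set t | t <= M])%classic.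
    apply: closedI; apply: preimage_closed => [v _|];
      by [exact: cont_defect|exact: cont_energy|exact: closed_le].
  by apply/seteqP; split=> v /= [/defectP ? ?].
have S0 : (S !=set0)%classic.
  by have [v [vE vT]] := frame_point fX; exists v; rewrite /S/= vE vT; split.
have [v /set_mem [fv vM] vmin] := compact_EVT_min S0
  (bounded_closed_compact (bounded_points M) cS) (continuous_subspaceT cont_energy).
exists (point_vec v), (point_form v); split=> // E' T' fE'.
have [le|/ltW le] := leP (energy a c E' T') M; last exact: le_trans vM le.
have [v' [v'E v'T]] := frame_point fE'; rewrite -v'E -v'T.
by apply: vmin; apply/mem_set; rewrite /S /= v'E v'T.
Qed.

End MinimalFrame.

(** * Signatures of the Ricci form *)

Section Realization.
Variables (R : realType) (n : lieAlgType R).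
Local Notation d := (\dim {:n}).
Hypothesis nil_n : lie_nilpotent n.

Lemma ex_metric_signature (A K : {vspace n}) : (A <= K)%VS ->
  (A + lie_derived n)%VS = fullv -> (K :&: lie_center n)%VS = 0%VS ->
  exists (g : {dot n for idfun}) (e : d.-tuple n), [/\ orthonormal_basis g e,
    max_posdef_dim (fun x y => - ricci g e x y) = \dim A &
    (max_posdef_dim (ricci g e) + \dim K)%N = d].
Proof.
move=> AK AD Kz; pose a (l : 'I_(\dim A)) := (vbasis A)`_l.
(* The coordinates of the component of [x] off [K] have common kernel exactly [K]. *)
pose c (m : 'I_d) x := coord (vbasis {:n}) m (x - projv K x).
have cL m : scalar (c m).
  by move=> t x y; rewrite /c linearP /= opprD addrACA -scalerN -scalerDr linearP.
have cK : common_kernel cL = K.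
  apply/vspaceP => x; apply/mem_common_kernel/idP => [h|xK m].
    have /eqP : x - projv K x = 0.
      by rewrite (coord_vbasis (memvf (x - _))) big1// => m _; rewrite -/(c m x) h scale0r.
    by rewrite subr_eq0 => /eqP->; exact: memv_proj.
  by rewrite /c projv_id// subrr linear0.
have aA l : a l \in A by apply: vbasis_mem; rewrite mem_nth// size_tuple.
have spanA (x : n) (f : n -> R) : scalar f ->
    (forall l, f (a l) = 0) -> x \in A -> f x = 0.
  move=> fL fa xA; rewrite (coord_vbasis xA) (scalar_sum _ _ fL) big1// => l _.
  by rewrite fa mulr0.
have a_gen : (<<codom a>> + lie_derived n)%VS = fullv.
  apply: subv_anti; rewrite subvf /= -{1}AD addvS// -{1}(span_basis (vbasisP A)).
  apply: sub_span => x /(nthP 0)[l]; rewrite size_tuple => lA <-.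
  by apply/codomP; exists (Ordinal lA).
have c_sep : (common_kernel cL :&: lie_center n)%VS = 0%VS by rewrite cK.
have [E [T [ET min]]] := ex_min_frame nil_n a_gen c_sep.
have ric := ricci_min_frame cL ET min.
set g := frame_dot ET in ric; set e := frame_tuple E in ric.
exists g, e; split; first exact: frame_orthonormal.
  (* On [A], inside [K], the forms [c] vanish and the Ricci form is negative definite; on the
     orthogonal complement of [A] it is nonnegative. *)
  apply: (max_posdef_dimE (W := orthov_of g A)); last exact: dim_orthov_of.
    move=> x xA x0; rewrite ric [X in X - _]big1 => [|m _]; last first.
      have : x \in common_kernel cL by rewrite cK (subvP AK).
      by move=> /mem_common_kernel->; rewrite expr0n.
    rewrite sub0r mulrN opprK mulr_gt0 ?divr_gt0// lt_def sumr_ge0 ?andbT => [|l _].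
      apply: contra_neq x0 => /eqP; rewrite psumr_eq0 => [/allP h|l _]; last exact: sqr_ge0.
      apply: (dot_eq0 (g := g)); apply: spanA (dot_scalar g x) _ xA => l.
      by have := h l (mem_index_enum l); rewrite sqrf_eq0 => /eqP.
    exact: sqr_ge0.
  move=> x /mem_orthov_of xO; rewrite ric [X in _ - X]big1 => [|l _]; last first.
    by rewrite xO// expr0n.
  by rewrite subr0 oppr_le0 mulr_ge0 ?divr_ge0// sumr_ge0// => m _; exact: sqr_ge0.
(* Orthogonally to [K], hence to [A], only the squares of the [c m] remain and they separate points;
   on [K] the form is nonpositive. *)
rewrite -(dim_orthov_ofE g K) addnC; congr addn.
apply: (max_posdef_dimE (W := K)); last by rewrite addnC dim_orthov_ofE.
  move=> x /mem_orthov_of xO x0; rewrite ric [X in _ - X]big1 => [|l _]; last first.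
    by rewrite xO ?expr0n// (subvP AK).
  rewrite subr0 mulr_gt0 ?divr_gt0// lt_def sumr_ge0 ?andbT => [|m _]; last exact: sqr_ge0.
  apply: contra_neq x0 => /eqP; rewrite psumr_eq0 => [/allP h|m _]; last exact: sqr_ge0.
  apply: (dot_eq0 (g := g)); apply: xO; rewrite -cK; apply/mem_common_kernel => m.
  by have := h m (mem_index_enum m); rewrite sqrf_eq0 => /eqP.
move=> x xK; rewrite ric [X in X - _]big1 => [|m _]; last first.
  by move: xK; rewrite -cK => /mem_common_kernel->; rewrite expr0n.
by rewrite sub0r mulrN oppr_le0 mulr_ge0 ?divr_ge0// sumr_ge0// => l _; exact: sqr_ge0.
Qed.

End Realization.

(** A complement [U] of [D] misses [Z], so it extends to a complement [K'] of [Z]. Both [A] and [K]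
    are then interpolated between [U] and [K'], where the dimension hypotheses leave room. *)
Lemma ex_flag (F : fieldType) (V : vectType F) (D Z : {vspace V}) k l :
  (Z <= D)%VS -> (\dim {:V} - \dim D <= k)%N -> (\dim Z <= l)%N ->
  (k + l <= \dim {:V})%N ->
  exists A K : {vspace V}, [/\ (A <= K)%VS, (A + D)%VS = fullv,
    (K :&: Z)%VS = 0%VS, \dim A = k & (\dim K + l)%N = \dim {:V}].
Proof.
move=> ZD kD lZ kl; pose U := (D^C)%VS; pose K' := (U + (U + Z)^C)%VS.
have dU : \dim U = (\dim {:V} - \dim D)%N by rewrite dimv_compl.
have UZ : (U :&: Z)%VS = 0%VS.
  apply/eqP; rewrite -subv0 -(capv_compl D) capvC capvS//.
have dUZ : \dim (U + Z) = (\dim U + \dim Z)%N by rewrite dimv_disjoint_sum.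
have K'Z : (K' + Z)%VS = fullv by rewrite /K' -addvA [(_ + Z)%VS]addvC addvA addv_complf.
have leD (W W' : {vspace V}) : (\dim (W + W') <= \dim W + \dim W')%N.
  by rewrite dimv_add_leqif.
have dK' : (\dim K' + \dim Z = \dim {:V})%N.
  have := leD U ((U + Z)^C)%VS; have := leD K' Z; rewrite K'Z -/K' dimv_compl dUZ.
  by have := dimvS (subvf (U + Z)); rewrite dUZ; lia.
have K'Z0 : (K' :&: Z)%VS = 0%VS.
  by apply/eqP; rewrite -dimv_eq0; have := dimv_sum_cap K' Z; rewrite K'Z; lia.
have [||K [UK KK' dK]] := @ex_subv_dim _ _ U K' (\dim {:V} - l); first exact: addvSl.
  by lia.
have [||A [UA AK dA]] := @ex_subv_dim _ _ U K k; [by []|by lia|].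
exists A, K; split=> //; last by lia.
  apply: subv_anti; rewrite subvf /= -(addv_complf D) addvC addvS//.
by apply/eqP; rewrite -subv0 -K'Z0 capvS.
Qed.

(** * The set of Ricci signatures *)

Local Open Scope classical_set_scope.

Theorem corollary2 (R : realType) (n : lieAlgType R)
  (nil_n : lie_nilpotent n)
  (cen_n : (lie_center n <= lie_derived n)%VS) :
  let u : int := (\dim {:n})%:Z - (\dim (lie_derived n + lie_center n)%VS)%:Z in
  let z : int := (\dim (lie_center n :&: lie_derived n)%VS)%:Z in
  sigma_ric n =
    [set s : int * int * int |
       let '(sm, s0, sp) := s in
       [/\ u <= sm, 0 <= s0, z <= sp & sm + s0 + sp = (\dim {:n})%:Z]].
Proof.
move=> u z.
have uE : u = (\dim {:n})%:Z - (\dim (lie_derived n))%:Z.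
  by rewrite /u (addv_idPl cen_n).
have zE : z = (\dim (lie_center n))%:Z by rewrite /z (capv_idPl cen_n).
apply/seteqP; split=> [_ [g [e [e_on ->]]]|[[sm s0] sp] /= [usm s00 zsp ssum]].
  (* Every metric obeys the bounds: the center bounds the positive index, the orthogonal complement
     of the derived algebra the negative one. *)
  have := leq_max_posdef_dim (ricci_posdef_center e_on cen_n).
  have := leq_max_posdef_dim (ricci_negdef_orthov e_on cen_n).
  have := dim_orthov_of g (lie_derived n).
  have := posdef_dim_add_leq (ricci g e).
  rewrite /signature /=; set P := max_posdef_dim _; set M := max_posdef_dim _.
  by move=> ? ? ? ?; split; lia.
(* Conversely, [sm] is a natural number because [u], the codimension of the derived algebra, is
   nonnegative. *)
have [k smE] : exists k : nat, sm = k%:Z.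
  have := dimvS (subvf (lie_derived n)); exists `|sm|%N; lia.
have [l spE] : exists l : nat, sp = l%:Z by exists `|sp|%N; lia.
have [|||A [K [AK AD Kz dA dK]]] := @ex_flag _ n _ _ k l cen_n; try lia.
have [g [e [e_on negE posE]]] := ex_metric_signature nil_n AK AD Kz.
exists g, e; split=> //; rewrite /signature negE dA.
have -> : max_posdef_dim (ricci g e) = l by lia.
by rewrite smE spE; congr (_, _, _); lia.
Qed.
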